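(* Let $\rho\ge0$ and let $f:\mathbb{R}^n\to\overline{\mathbb{R}}$ be a proper closed $\rho$-weakly convex function with $S=\operatorname{argmin}_{x\in\mathbb{R}^n}f(x)\neq\emptyset$ and $f^\star=\min_x f(x)$. Let $\nu>0$ and suppose $f$ satisfies quadratic growth with a constant $\mu_{\mathrm q}>\rho$ over the sublevel set $[f\le f^\star+\nu]$, i.e. $$\frac{\mu_{\mathrm q}}{2}\,\mathrm{dist}^2(x,S)\le f(x)-f^\star\qquad\forall x\in[f\le f^\star+\nu].$$ Let $\beta=\mu_{\mathrm q}-\rho>0$. Let $\{c_k\}_{k\ge0}$ be any positive sequence with $1/c_k>\rho$ for all $k\ge0$, let $x_0\in[f\le f^\star+\nu]$, and let $\{x_k\}$ be generated by the proximal point method $$x_{k+1}=\operatorname{argmin}_{x\in\mathbb{R}^n}\ f(x)+\frac{1}{2c_k}\|x-x_k\|^2,\qquad k=0,1,2,\dots$$ Then for all $k\ge0$, $$f(x_{k+1})-f^\star\le\omega_k\,(f(x_k)-f^\star),\qquad \mathrm{dist}(x_{k+1},S)\le\theta_k\,\mathrm{dist}(x_k,S),$$ where $$\omega_k=\frac{1}{1+\mu_{\mathrm p}c_k}<1,\qquad \theta_k=\min\left\{\frac{1}{\sqrt{c_k\beta+1}},\ \frac{1}{\sqrt{c_k^2/\mu_{\mathrm e}^2+1}}\right\}<1,$$ with $\mu_{\mathrm p}$ any number in $\left(0,\frac{(\mu_{\mathrm q}-\rho)^2}{4\mu_{\mathrm q}}\right]$ and $\mu_{\mathrm e}$ any number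 in $\left[\frac{2}{\mu_{\mathrm q}-\rho},+\infty\right)$.
   Context: $\overline{\mathbb{R}}=\mathbb{R}\cup\{\pm\infty\}$; $\|\cdot\|$ is the Euclidean norm. $f$ is proper if $f>-\infty$ everywhere and $f(x)<\infty$ for some $x$; closed if its epigraph is closed; $\rho$-weakly convex if $f+\frac{\rho}{2}\|\cdot\|^2$ is convex. $\mathrm{dist}(x,C)=\min_{y\in C}\|x-y\|$ and $[f\le a]=\{x:f(x)\le a\}$. The ranges for $\mu_{\mathrm p}$ and $\mu_{\mathrm e}$ are those in the paper's table of constants deduced from quadratic growth with $\mu_{\mathrm q}>\rho$: they are constants for the Polyak–Łojasiewicz inequality $2\mu_{\mathrm p}(f(x)-f^\star)\le\mathrm{dist}^2(0,\hat\partial f(x))$ and the error bound $\mathrm{dist}(x,S)\le\mu_{\mathrm e}\,\mathrm{dist}(0,\hat\partial f(x))$ on $[f\le f^\star+\nu]$, where $\hat\partial f$ denotes the Fréchet subdifferential. *)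

(* Defs.v *)
From mathcomp Require Import all_boot all_order all_algebra.
From mathcomp Require Import all_classical all_reals all_analysis.

Set Implicit Arguments.
Unset Strict Implicit.
Unset Printing Implicit Defensive.

Import Order.TTheory GRing.Theory Num.Theory.
Import numFieldNormedType.Exports.

Local Open Scope classical_set_scope.
Local Open Scope ring_scope.
Local Open Scope ereal_scope.

(* The library norm `|x| on 'rV[R]_n is the sup norm, hence this definition.
   Both norms induce the library topology of 'rV[R]_n. *)
Definition enorm (R : realType) (n : nat) (x : 'rV[R]_n) : R :=
  Num.sqrt (\sum_(i < n) x ord0 i ^+ 2)%R.

(* The infimum is a minimum when C is closed and nonempty; it is 0 by
   convention when C is empty. *)
Definition dist (R : realType) (n : nat) (x : 'rV[R]_n) (C : set 'rV[R]_n) : R :=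
  inf [set enorm (x - y)%R | y in C].

Definition proper_fun (R : realType) (n : nat) (f : 'rV[R]_n -> \bar R) : Prop :=
  (forall x, -oo < f x) /\ (exists x, f x < +oo).

(* R^o is R seen as a module over itself, so that the product is an lmodType
   and convex_set applies. *)
Definition epigraph (R : realType) (n : nat) (f : 'rV[R]_n -> \bar R) :
    set ('rV[R]_n * R^o) :=
  [set p | f p.1 <= (p.2 : R)%:E].

Definition closed_fun (R : realType) (n : nat) (f : 'rV[R]_n -> \bar R) : Prop :=
  closed (epigraph f).

Definition convex_fun (R : realType) (n : nat) (f : 'rV[R]_n -> \bar R) : Prop :=
  convex_set (epigraph f).

Definition weakly_convex (R : realType) (n : nat) (rho : R)
    (f : 'rV[R]_n -> \bar R) : Prop :=
  convex_fun (fun x => f x + (rho / 2 * enorm x ^+ 2)%:E).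

Definition sublevel (R : realType) (n : nat) (f : 'rV[R]_n -> \bar R)
    (a : \bar R) : set 'rV[R]_n :=
  [set x | f x <= a].

Definition argmin (R : realType) (n : nat) (f : 'rV[R]_n -> \bar R) :
    set 'rV[R]_n :=
  [set x | forall y, f x <= f y].

(* Equal to f x for every x in argmin f, hence the minimum when it exists. *)
Definition minval (R : realType) (n : nat) (f : 'rV[R]_n -> \bar R) : \bar R :=
  ereal_inf (range f).

Definition quadratic_growth (R : realType) (n : nat) (f : 'rV[R]_n -> \bar R)
    (muq : R) (A : set 'rV[R]_n) : Prop :=
  forall x, A x ->
    (muq / 2 * dist x (argmin f) ^+ 2)%:E <= f x - minval f.

Definition prox_objective (R : realType) (n : nat) (f : 'rV[R]_n -> \bar R)
    (c : R) (z x : 'rV[R]_n) : \bar R :=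
  f x + (1 / (2 * c) * enorm (x - z) ^+ 2)%:E.

(* The minimizer is unique when f is proper, closed and rho-weakly convex with
   rho < 1 / c k, so membership expresses x k.+1 = argmin. *)
Definition proximal_point_sequence (R : realType) (n : nat)
    (f : 'rV[R]_n -> \bar R) (c : nat -> R) (x : nat -> 'rV[R]_n) : Prop :=
  forall k, argmin (prox_objective f (c k) (x k)) (x k.+1).

(* Main.v *)
Require Import Defs.
From mathcomp Require Import all_boot all_order all_algebra.
From mathcomp Require Import all_classical all_reals all_analysis.
From mathcomp Require Import ring lra.

Set Implicit Arguments.
Unset Strict Implicit.

Import Order.TTheory GRing.Theory Num.Theory.
Import numFieldNormedType.Exports.

Local Open Scope classical_set_scope.
Local Open Scope ring_scope.

(** Write [p] for the proximal point of [x] with step [c], [S] for the set of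
    minimizers, [D] for the gap [f p - min f] and [d] for the distance from [p]
    to [S].

    Optimality of [p] along segments, combined with weak convexity, says that
    [g = (x - p) / c] is a proximal subgradient of [f] at [p]:
    [f y >= f p + <g, y - p> - rho / 2 * |y - p|^2] ([prox_variational]).
    Everything else is this inequality with [y] in [S], used in two ways.

    Expanding [|y - x|^2] around [p] and bounding [D] below by quadratic growth
    gives [(c * (muq - rho) + 1) * d^2 + |x - p|^2 <= dist x S ^ 2]
    ([prox_pythagoras]). Dropping [|x - p|^2] yields the first contraction factor.

    By Cauchy-Schwarz, [D <= |g| * d + rho / 2 * d^2] ([prox_gap_le]). Quadratic
    growth [muq / 2 * d^2 <= D] with [muq > rho] absorbs the last term, which gives
    both an error bound [d <= 2 / (muq - rho) * |g|] and a Polyak-Lojasiewicz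
    inequality for [D]. Since [|x - p| = c * |g|], the error bound makes the term
    [|x - p|^2] of [prox_pythagoras] at least [c^2 / mue^2 * d^2], which is the
    second contraction factor. The Polyak-Lojasiewicz inequality makes the decrease
    [f x - f p >= c / 2 * |g|^2] at least [mup * c * D], which is the rate for the
    function values. *)

(** * The Euclidean norm and its inner product *)

Definition dotp (R : realType) (n : nat) (u v : 'rV[R]_n) : R :=
  \sum_(i < n) u ord0 i * v ord0 i.

Lemma enorm_ge0 (R : realType) (n : nat) (u : 'rV[R]_n) : 0 <= enorm u.
Proof. exact: sqrtr_ge0. Qed.

Lemma enorm_sqr (R : realType) (n : nat) (u : 'rV[R]_n) :
  enorm u ^+ 2 = \sum_(i < n) u ord0 i ^+ 2.
Proof. by rewrite /enorm sqr_sqrtr// sumr_ge0// => i _; exact: sqr_ge0. Qed.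

Lemma enormB (R : realType) (n : nat) (u v : 'rV[R]_n) :
  enorm (u - v) = enorm (v - u).
Proof.
by congr Num.sqrt; apply: eq_bigr => i _; rewrite !mxE -sqrrN opprB.
Qed.

Lemma enorm_sqrDZ (R : realType) (n : nat) (u v : 'rV[R]_n) (t : R) :
  enorm (u + t *: v) ^+ 2 =
  enorm u ^+ 2 + 2 * t * dotp u v + t ^+ 2 * enorm v ^+ 2.
Proof.
rewrite !enorm_sqr /dotp !mulr_sumr -!big_split/=.
by apply: eq_bigr => i _; rewrite !mxE; ring.
Qed.

Lemma enorm_sqrD (R : realType) (n : nat) (u v : 'rV[R]_n) :
  enorm (u + v) ^+ 2 = enorm u ^+ 2 + 2 * dotp u v + enorm v ^+ 2.
Proof. by rewrite -[v in LHS]scale1r enorm_sqrDZ; ring. Qed.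

(** Cauchy-Schwarz: [t |-> enorm (u + t *: v) ^+ 2] is a nonnegative quadratic
    polynomial, hence has a nonpositive discriminant. *)
Lemma dotp_le_enorm (R : realType) (n : nat) (u v : 'rV[R]_n) :
  dotp u v <= enorm u * enorm v.
Proof.
have uv0 : 0 <= enorm u * enorm v by rewrite mulr_ge0// enorm_ge0.
suff : dotp u v ^+ 2 <= (enorm u * enorm v) ^+ 2.
  by have [/le_trans->//|d0] := leP (dotp u v) 0; rewrite ler_sqr// nnegrE ltW.
pose q := Poly [:: enorm u ^+ 2; 2 * dotp u v; enorm v ^+ 2].
have : q`_1 ^+ 2 - 4 * q`_2 * q`_0 <= 0.
  apply: deg_le2_poly_ge0; first exact: size_Poly.
  move=> t; rewrite horner_Poly/=.
  have := sqr_ge0 (enorm (u + t *: v)); rewrite enorm_sqrDZ.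
  by congr (0 <= _); ring.
by rewrite !coef_Poly/= => h; nra.
Qed.

(** * Distance to a set *)

Section Dist.
Variables (R : realType) (n : nat) (C : set 'rV[R]_n).
Implicit Types x y : 'rV[R]_n.

Lemma le_dist x r :
  C !=set0 -> (forall y, C y -> r <= enorm (x - y)) -> r <= dist x C.
Proof.
move=> [y0 Cy0] lb; apply: lb_le_inf; first by exists (enorm (x - y0)), y0.
by move=> _ [y Cy <-]; exact: lb.
Qed.

Lemma dist_le x y : C y -> dist x C <= enorm (x - y).
Proof.
move=> Cy; apply: ge_inf; last by exists y.
by exists 0 => _ [z _ <-]; exact: enorm_ge0.
Qed.

Lemma dist_ge0 x : C !=set0 -> 0 <= dist x C.
Proof. by move=> C0; apply: le_dist => // y _; exact: enorm_ge0. Qed.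

Lemma dist_lt x t : C !=set0 -> dist x C < t -> exists2 y, C y & enorm (x - y) < t.
Proof.
move=> [y0 Cy0] /inf_lt[|_ [y Cy <-] yt]; first by exists (enorm (x - y0)), y0.
by exists y.
Qed.

(** An upper bound quadratic in the distance to each point passes to the
    distance to the set by continuity, whether or not that distance is attained. *)
Lemma le_quadratic_dist x (D a b : R) : C !=set0 -> 0 <= a -> 0 <= b ->
  (forall y, C y -> D <= a * enorm (x - y) + b * enorm (x - y) ^+ 2) ->
  D <= a * dist x C + b * dist x C ^+ 2.
Proof.
move=> C0 a0 b0 ub; set d := dist x C.
have d0 : 0 <= d by exact: dist_ge0.
apply/ler_addgt0Pr => e e0.
pose K := a + b * (2 * d + 1).
have K0 : 0 <= K by rewrite /K; nra.
(* with 0 < r <= 1 the bound grows by at most r * K when d becomes d + r *)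
pose r := Num.min 1 (e / (K + 1)).
have r0 : 0 < r by rewrite lt_min ltr01/= divr_gt0//; lra.
have r1 : r <= 1 by rewrite ge_min lexx.
have rK : r * (K + 1) <= e.
  by rewrite -ler_pdivlMr; [rewrite ge_min lexx orbT|lra].
have [y Cy yd] : exists2 y, C y & enorm (x - y) < d + r.
  by apply: dist_lt => //; rewrite ltrDl.
apply: (le_trans (ub _ Cy)).
have y0 := enorm_ge0 (x - y); move: (enorm (x - y)) y0 yd => s s0 sd.
have h1 : a * s <= a * (d + r) by rewrite ler_wpM2l// ltW.
have h2 : b * s ^+ 2 <= b * (d + r) ^+ 2.
  by rewrite ler_wpM2l// ler_sqr ?nnegrE; lra.
have h3 : b * r ^+ 2 <= b * r by rewrite ler_wpM2l// expr2; nra.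
by apply: (le_trans (lerD h1 h2)); move: rK; rewrite /K; nra.
Qed.

End Dist.

(** * The variational inequality of a proximal step *)

(** Subtracting [rho / 2 * enorm ^+ 2] from a convex function weakens convexity on
    a segment by exactly the last term, since the squared norm is a quadratic form. *)
Lemma weakly_convex_segment (R : realType) (n : nat) (rho : R)
    (f : 'rV[R]_n -> \bar R) (p y : 'rV[R]_n) (a b t : R) :
  weakly_convex rho f -> f p = a%:E -> f y = b%:E -> 0 <= t <= 1 ->
  (f (p + t *: (y - p))%R <=
   ((1 - t) * a + t * b + rho / 2 * (t * (1 - t)) * enorm (y - p) ^+ 2)%:E)%E.
Proof.
move=> wf fp fy /andP[t0 t1].
have := wf (y, b + rho / 2 * enorm y ^+ 2) (p, a + rho / 2 * enorm p ^+ 2) (Itv01 t0 t1).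
rewrite !inE /epigraph/= fp fy -!EFinD => /(_ (lexx _) (lexx _)).
have -> : t *: y + unstable.onem t *: p = p + t *: (y - p).
  by apply/rowP => i; rewrite !mxE /unstable.onem; ring.
(* all norms are expressed through p and y - p, so that both sides agree *)
have := enorm_sqrD p (y - p); rewrite subrKC => ->.
rewrite enorm_sqrDZ /unstable.onem /GRing.scale/=.
case: (f _) => [r| |] //=; rewrite ?leNye// !lee_fin => h.
by rewrite -subr_ge0; move: h; rewrite -subr_ge0; congr (0 <= _); field.
Qed.

(** The vector [(x - p) / c] is a proximal subgradient of [f] at [p]. Comparing
    [p] with the points [p + t *: (y - p)] of the segment towards [y] gives the
    inequality up to an error linear in [t], and [t] is arbitrarily small. *)
Lemma prox_variational (R : realType) (n : nat) (rho c : R)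
    (f : 'rV[R]_n -> \bar R) (x p y : 'rV[R]_n) (a b : R) :
  weakly_convex rho f -> 0 < c -> argmin (prox_objective f c x) p ->
  f p = a%:E -> f y = b%:E ->
  a <= b + rho / 2 * enorm (y - p) ^+ 2 + dotp (p - x) (y - p) / c.
Proof.
move=> wf c0 pmin fp fy; apply/ler_addgt0Pr => e e0.
set A := enorm (y - p) ^+ 2; set B := dotp (p - x) (y - p).
(* comparison with p + t *: (y - p), divided by t, has the error term
   t * (A / (2 * c) - rho / 2 * A) *)
pose K := `|A / (2 * c) - rho / 2 * A| + 1.
have K0 : 0 < K by rewrite ltr_wpDl.
pose t := Num.min 1 (e / K).
have t0 : 0 < t by rewrite lt_min ltr01 divr_gt0.
have t1 : t <= 1 by rewrite ge_min lexx.
have tK : t * K <= e by rewrite -ler_pdivlMr// ge_min lexx orbT.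
have t01 : 0 <= t <= 1 by rewrite (ltW t0) t1.
have seg := weakly_convex_segment wf fp fy t01.
have := pmin (p + t *: (y - p)); rewrite /prox_objective fp.
have -> : p + t *: (y - p) - x = (p - x) + t *: (y - p) by rewrite addrAC.
rewrite (enorm_sqrDZ (p - x)) -/A -/B -EFinD.
move=> /le_trans/(_ (leeD2r _ seg)); rewrite -EFinD lee_fin -/A => h.
have KA : A / (2 * c) - rho / 2 * A <= K.
  by apply: (le_trans (ler_norm _)); rewrite lerDl.
suff : t * a <= t * (b + rho / 2 * A + B / c + e) by rewrite ler_pM2l.
have : t * (t * (A / (2 * c) - rho / 2 * A)) <= t * e.
  by rewrite ler_pM2l//; apply: (le_trans _ tK); rewrite ler_pM2l.
suff : t * a <= t * (b + rho / 2 * A + B / c) + t * (t * (A / (2 * c) - rho / 2 * A)).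
  by lra.
rewrite -subr_ge0; move: h; rewrite -subr_ge0; congr (0 <= _).
by field; rewrite gt_eqF.
Qed.

(** * Consequences for one proximal step *)

(** Here [d] stands for the distance to the minimizers, [D] for the gap and [G] for
    the norm of a subgradient: growth from below and the subgradient inequality
    from above pinch [D], and the result is divided by [d]. *)
Lemma error_bound_of_growth (R : realFieldType) (rho muq G d D : R) :
  0 <= d -> 0 <= G -> muq / 2 * d ^+ 2 <= D -> D <= G * d + rho / 2 * d ^+ 2 ->
  (muq - rho) / 2 * d <= G.
Proof.
move=> d0 G0 qg ub; have [->|dn0] := eqVneq d 0; first by rewrite mulr0.
have dgt0 : 0 < d by rewrite lt0r dn0.
by rewrite -(ler_pM2r dgt0); nra.
Qed.

(** The Polyak-Lojasiewicz inequality, with the quantities of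
    [error_bound_of_growth]: after absorption, [(muq - rho) * D <= muq * G * d], and
    growth bounds [d] by a multiple of the square root of [D]. *)
Lemma PL_of_growth (R : realFieldType) (rho muq G d D : R) :
  0 <= rho -> rho < muq -> 0 <= d -> 0 <= G ->
  muq / 2 * d ^+ 2 <= D -> D <= G * d + rho / 2 * d ^+ 2 ->
  (muq - rho) ^+ 2 / (2 * muq) * D <= G ^+ 2.
Proof.
move=> rho0 rhom d0 G0 qg ub.
have m0 : 0 < muq by lra.
have D0 : 0 <= D by apply: le_trans qg; rewrite mulr_ge0 ?sqr_ge0//; lra.
(* the term rho / 2 * d ^+ 2 is absorbed by growth: it is at most rho / muq * D *)
have h : (muq - rho) * D <= muq * G * d by nra.
have h2 : ((muq - rho) * D) ^+ 2 <= (muq * G * d) ^+ 2.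
  by rewrite ler_sqr ?nnegrE// !mulr_ge0//; lra.
have h3 : (muq * G * d) ^+ 2 <= 2 * muq * G ^+ 2 * D.
  have := ler_wpM2l (mulr_ge0 (ltW m0) (sqr_ge0 G)) qg.
  by nra.
have [D00|Dn0] := eqVneq D 0; first by rewrite D00 mulr0 sqr_ge0.
have Dgt0 : 0 < D by rewrite lt0r Dn0.
rewrite mulrAC ler_pdivrMr; last by lra.
rewrite -(ler_pM2r Dgt0).
have -> : (muq - rho) ^+ 2 * D * D = ((muq - rho) * D) ^+ 2 by ring.
have -> : G ^+ 2 * (2 * muq) * D = 2 * muq * G ^+ 2 * D by ring.
exact: le_trans h3.
Qed.

(** In the three-point identity for [enorm (s - x) ^+ 2], convexity turns the
    cross term into [2 * c] times the gap [D], which growth bounds below. *)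
Lemma prox_pythagoras (R : realType) (n : nat) (rho muq c D : R)
    (S : set 'rV[R]_n) (x p : 'rV[R]_n) :
  S !=set0 -> 0 < c -> c * rho <= 1 -> rho <= muq ->
  muq / 2 * dist p S ^+ 2 <= D ->
  (forall s, S s ->
     D <= rho / 2 * enorm (s - p) ^+ 2 + dotp (p - x) (s - p) / c) ->
  (c * (muq - rho) + 1) * dist p S ^+ 2 + enorm (p - x) ^+ 2 <= dist x S ^+ 2.
Proof.
move=> S0 c0 crho rhom qg var.
set L := _ + _.
have d0 : 0 <= dist p S by exact: dist_ge0.
have L0 : 0 <= L.
  rewrite addr_ge0 ?sqr_ge0// mulr_ge0 ?sqr_ge0// addr_ge0// mulr_ge0 ?(ltW c0)//.
  by rewrite subr_ge0.
rewrite -(sqr_sqrtr L0) ler_sqr ?nnegrE ?sqrtr_ge0 ?dist_ge0//.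
apply: le_dist => // s Ss; rewrite -[leRHS]ger0_norm ?enorm_ge0// -sqrtr_sqr.
rewrite ler_sqrt ?sqr_ge0// enormB.
have -> : s - x = (p - x) + (s - p) by rewrite [RHS]addrC subrKA.
rewrite enorm_sqrD /L.
have dA : dist p S ^+ 2 <= enorm (s - p) ^+ 2.
  by rewrite ler_sqr ?nnegrE ?enorm_ge0// enormB dist_le.
have := var s Ss; move: (dotp _ _) (enorm (s - p) ^+ 2) (enorm (p - x) ^+ 2) dA => B A G dA.
move: (dist p S ^+ 2) qg dA => d qg dA ub.
have h1 : c * D <= c * (rho / 2 * A) + B.
  by move: ub; rewrite -(ler_pM2l c0) mulrDr [c * (B / c)]mulrC divfK// gt_eqF.
have h2 : c * (muq / 2 * d) <= c * D by rewrite ler_pM2l.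
have h3 : (1 - c * rho) * d <= (1 - c * rho) * A by rewrite ler_wpM2l// subr_ge0.
by nra.
Qed.

(** Cauchy-Schwarz makes the subgradient inequality depend on the minimizer only
    through its distance to [p], so the best minimizer may be taken. *)
Lemma prox_gap_le (R : realType) (n : nat) (rho c D : R)
    (S : set 'rV[R]_n) (x p : 'rV[R]_n) :
  S !=set0 -> 0 < c -> 0 <= rho ->
  (forall s, S s ->
     D <= rho / 2 * enorm (s - p) ^+ 2 + dotp (p - x) (s - p) / c) ->
  D <= enorm (p - x) / c * dist p S + rho / 2 * dist p S ^+ 2.
Proof.
move=> S0 c0 rho0 var; apply: le_quadratic_dist => //.
- by rewrite divr_ge0 ?enorm_ge0// ltW.
- by rewrite divr_ge0.
move=> s Ss; rewrite (enormB p s) addrC; apply: (le_trans (var s Ss)).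
by rewrite lerD2l mulrAC ler_pM2r ?invr_gt0// dotp_le_enorm.
Qed.

Lemma prox_descent (R : realType) (n : nat) (f : 'rV[R]_n -> \bar R) (c : R)
    (x p : 'rV[R]_n) :
  argmin (prox_objective f c x) p ->
  (f p + (1 / (2 * c) * enorm (p - x) ^+ 2)%:E <= f x)%E.
Proof.
move=> /(_ x); rewrite /prox_objective subrr.
suff -> : enorm (0 : 'rV[R]_n) ^+ 2 = 0 by rewrite mulr0 adde0.
by rewrite enorm_sqr big1// => i _; rewrite mxE expr0n.
Qed.

Lemma minval_argmin (R : realType) (n : nat) (f : 'rV[R]_n -> \bar R)
    (s : 'rV[R]_n) : argmin f s -> minval f = f s.
Proof.
move=> fs; apply/eqP; rewrite eq_le; apply/andP; split.
  by apply: ge_ereal_inf; exists (f s) => //; exists s.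
by apply: le_ereal_inf_tmp => _ [y _ <-]; exact: fs.
Qed.

Lemma ler_div_sqrt (R : rcfType) (K a b : R) :
  0 < K -> 0 <= a -> 0 <= b -> K * a ^+ 2 <= b ^+ 2 -> a <= 1 / Num.sqrt K * b.
Proof.
move=> K0 a0 b0 h; rewrite mul1r mulrC ler_pdivlMr ?sqrtr_gt0//.
rewrite -ler_sqr ?nnegrE ?mulr_ge0 ?sqrtr_ge0//.
by rewrite exprMn (sqr_sqrtr (ltW K0)) mulrC.
Qed.

Theorem theorem4p3 (R : realType) (n : nat) (rho : R) (f : 'rV[R]_n -> \bar R)
    (nu muq : R) (c : nat -> R) (x : nat -> 'rV[R]_n) (mup mue : R) :
  0 <= rho ->
  proper_fun f -> closed_fun f -> weakly_convex rho f ->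
  argmin f !=set0 ->
  0 < nu -> rho < muq ->
  quadratic_growth f muq (sublevel f (minval f + nu%:E)%E) ->
  (forall k, 0 < c k) -> (forall k, rho < 1 / c k) ->
  sublevel f (minval f + nu%:E)%E (x 0%N) ->
  proximal_point_sequence f c x ->
  0 < mup -> mup <= (muq - rho) ^+ 2 / (4 * muq) ->
  2 / (muq - rho) <= mue ->
  let beta := muq - rho in
  let omega k := 1 / (1 + mup * c k) in
  let theta k := Num.min (1 / Num.sqrt (c k * beta + 1))
                         (1 / Num.sqrt (c k ^+ 2 / mue ^+ 2 + 1)) in
  forall k : nat,
    [/\ (f (x k.+1) - minval f <= (omega k)%:E * (f (x k) - minval f))%E,
        dist (x k.+1) (argmin f) <= theta k * dist (x k) (argmin f),
        omega k < 1
      & theta k < 1].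
Proof.
move=> rho0 [fgtNy [xfin fxfin]] _ wf S0 nu0 rhom qg c0 rhoc x0 ppa mup0 mupb mueb.
move=> beta omega theta k.
have descent j : (f (x j.+1) <= f (x j))%E.
  apply: le_trans (prox_descent (ppa j)); rewrite leeDl// lee_fin.
  by rewrite mulr_ge0 ?sqr_ge0// divr_ge0// mulr_ge0// ltW.
have sub j : sublevel f (minval f + nu%:E)%E (x j).
  by elim: j => [//|j IH]; exact: le_trans (descent j) IH.
(* the minimum and the values along the sequence are real numbers *)
have [s Ss] := S0; have fmin := minval_argmin Ss.
have [m fm] : exists m, minval f = m%:E.
  rewrite fmin; have := fgtNy s; have := le_lt_trans (Ss xfin) fxfin.
  by case: (f s) => // r _ _; exists r.
have finite j : exists a, f (x j) = a%:E.
  have := fgtNy (x j); have := sub j; rewrite /sublevel/= fm.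
  by case: (f (x j)) => // r _ _; exists r.
have [[a fx] [b fp]] := (finite k, finite k.+1).
have ck := c0 k; set d := dist (x k.+1) (argmin f); set e := dist (x k) (argmin f).
have growth : muq / 2 * d ^+ 2 <= b - m.
  by have := qg _ (sub k.+1); rewrite fm fp -EFinB lee_fin.
have var s' : argmin f s' ->
    b - m <= rho / 2 * enorm (s' - x k.+1) ^+ 2
             + dotp (x k.+1 - x k) (s' - x k.+1) / c k.
  move=> Ss'; have fs' : f s' = m%:E by rewrite -fm (minval_argmin Ss').
  by have := prox_variational wf ck (ppa k) fp fs'; rewrite lerBlDl addrA.
have desc : b + 1 / (2 * c k) * enorm (x k.+1 - x k) ^+ 2 <= a.
  by have := prox_descent (ppa k); rewrite fx fp -EFinD lee_fin.
have crho : c k * rho <= 1 by rewrite mulrC -ler_pdivlMr// ltW.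
have pyth := prox_pythagoras S0 ck crho (ltW rhom) growth var.
have gap := prox_gap_le S0 ck rho0 var.
rewrite -/d -/e in pyth gap.
have d0 : 0 <= d by exact: dist_ge0.
have e0 : 0 <= e by exact: dist_ge0.
have beta0 : 0 < beta by rewrite subr_gt0.
have mue0 : 0 < mue by apply: lt_le_trans mueb; rewrite divr_gt0.
have muq0 : 0 < muq by exact: le_lt_trans rhom.
move: (enorm (x k.+1 - x k)) (enorm_ge0 (x k.+1 - x k)) desc pyth gap => r r0 desc pyth gap.
have G0 : 0 <= r / c k by rewrite divr_ge0// ltW.
have eb := error_bound_of_growth d0 G0 growth gap.
have pl := PL_of_growth rho0 rhom d0 G0 growth gap.
have gt1 K : 1 < K -> 1 / Num.sqrt K < 1.
  move=> K1; have K0 : 0 < Num.sqrt K by rewrite sqrtr_gt0 (lt_trans ltr01).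
  by rewrite ltr_pdivrMr// mul1r -[ltLHS]sqrtr1 ltr_sqrt// (lt_trans ltr01).
have cb0 : 0 < c k * beta by rewrite mulr_gt0.
have cm0 : 0 < c k ^+ 2 / mue ^+ 2 by rewrite divr_gt0 ?exprn_gt0.
have mc0 : 0 < mup * c k by rewrite mulr_gt0.
have b0 : 0 <= b - m by apply: le_trans growth; rewrite mulr_ge0 ?sqr_ge0// divr_ge0// ltW.
split.
(* value decrease r ^+ 2 / (2 * c k), bounded below by the PL inequality *)
- rewrite fx fp fm -!EFinB -EFinM lee_fin /omega mul1r mulrC ler_pdivlMr; last lra.
  have h1 : mup * (b - m) <= beta ^+ 2 / (4 * muq) * (b - m) by rewrite ler_wpM2r.
  have h2 : beta ^+ 2 / (4 * muq) * (b - m) <= (r / c k) ^+ 2 / 2.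
    rewrite ler_pdivlMr//; apply: le_trans pl; rewrite le_eqVlt; apply/orP; left.
    by apply/eqP; rewrite /beta; field; rewrite gt_eqF.
  have h3 : c k * (mup * (b - m)) <= c k * ((r / c k) ^+ 2 / 2).
    by rewrite ler_pM2l//; exact: le_trans h2.
  have h4 : c k * ((r / c k) ^+ 2 / 2) = 1 / (2 * c k) * r ^+ 2.
    by field; rewrite gt_eqF.
  by rewrite h4 in h3; lra.
- rewrite /theta minEle; case: ifP => _; apply: ler_div_sqrt => //; try lra.
  + by apply: le_trans pyth; rewrite lerDl sqr_ge0.
  + have db : d <= mue * (r / c k).
      apply: le_trans (_ : 2 / beta * (r / c k) <= _); last by rewrite ler_wpM2r.
      by rewrite mulrAC ler_pdivlMr// /beta; lra.
    have h : c k ^+ 2 / mue ^+ 2 * d ^+ 2 <= r ^+ 2.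
      have -> : r ^+ 2 = c k ^+ 2 / mue ^+ 2 * (mue * (r / c k)) ^+ 2.
        by field; rewrite !gt_eqF.
      by rewrite ler_pM2l// ler_sqr ?nnegrE// mulr_ge0// ltW.
    apply: le_trans pyth.
    have : 0 <= c k * beta * d ^+ 2 by rewrite mulr_ge0 ?sqr_ge0// ltW.
    by rewrite -/beta; lra.
- by rewrite /omega ltr_pdivrMr; lra.
- by rewrite /theta gt_min gt1//; lra.
Qed.
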